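(* All theorems of the normal modal system $K$ are preserved in $\vdash$: if a formula $\varphi$ in the language with connectives $\neg,\wedge,\vee,\Box$ is a theorem of $K$, then $\vdash\varphi$, where $\vdash$ is the derivability relation of the four-eight modal logic.
   Context: Language $\mathcal{L}^{\Box,\circ}$: formulas are built from a denumerable set $\mathrm{Var}$ of variables with unary connectives $\neg,\Box,\circ$ and binary connectives $\wedge,\vee$. Abbreviations: $\varphi\to\psi:=\neg\varphi\vee\psi$, $\varphi\leftrightarrow\psi:=(\varphi\to\psi)\wedge(\psi\to\varphi)$, $\Diamond\varphi:=\neg\Box\neg\varphi$, $\varphi\veebar\psi:=(\varphi\wedge\neg\psi)\vee(\neg\varphi\wedge\psi)$. For a set $\Sigma$ of formulas, $\Box\Sigma=\{\Box\alpha\mid\alpha\in\Sigma\}$ and $\circ\Sigma=\{\circ\alpha\mid\alpha\in\Sigma\}$. Derivability $\vdash$ (between sets of formulas and formulas) in the four-eight modal logic is the least relation that is reflexive ($\Sigma\vdash\varphi$ if $\varphi\in\Sigma$), monotone, closed under cut, and satisfies, for all formulas $\varphi,\psi$ and sets of formulas $\Lambda,\Gamma$: (CLM) all the following axioms and rules (of the system $\mathcal{B}_4^\circ$) for the language $\mathcal{L}^{\Box,\circ}$: the axioms and rules of classical propositional logic; (DB) $\vdash\circ\circ\varphi$; (BR) $\circ\varphi\dashv\vdash\circ\neg\varphi$; (BF) $\circ\varphi,\circ\psi\vdash\circ(\varphi\wedge\psi)$ and $\circ\varphi,\circ\psi\vdash\circ(\varphi\vee\psi)$; (AwB) $\varphi,\circ\varphi\vdash\circ(\varphi\vee\psi)$;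 (NwB) $\neg\varphi,\circ\varphi\vdash\circ(\varphi\wedge\psi)$; (NB) $\neg\circ\varphi,\circ\psi\vdash\neg\circ(\varphi\wedge\psi)\vee\neg\circ(\varphi\vee\psi)$; (TNB1) $\neg\circ\varphi,\neg\circ\psi,\varphi\wedge\psi\vdash\neg\circ(\varphi\wedge\psi)$; (TNB2) $\neg\circ\varphi,\neg\circ\psi,\neg(\varphi\vee\psi)\vdash\neg\circ(\varphi\wedge\psi)$; (BC) $\circ(\varphi\wedge\psi),\varphi\wedge\psi\vdash\circ\varphi\wedge\circ\psi$; (OV) $\circ\varphi\leftrightarrow\circ\psi,\varphi\leftrightarrow\neg\psi\vdash\circ(\varphi\wedge\psi)$; (IB) if $\vdash\varphi$ then $\vdash\circ\varphi$. (KA) $\vdash\Box(\varphi\to\psi)\to(\Box\varphi\to\Box\psi)$; (BB) $\Box\varphi,\circ\Box\varphi\vdash\Box\circ\varphi$; (FC) $\Diamond\varphi,\Diamond\neg\varphi\vdash\circ\Box\varphi$; (EA) $\neg\circ\Box\varphi\vdash\Diamond(\varphi\wedge\neg\circ\varphi)\veebar\Diamond(\neg\varphi\wedge\neg\circ\varphi)$; (IN) $\Lambda\cup\Box\Gamma\vdash\Box\varphi$ whenever $\Lambda\cup\Gamma\cup\circ\Gamma\vdash\varphi\wedge\circ\varphi$ and $\Lambda\cup\Gamma\vdash\varphi$. *)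

(* Defs.v *)
From mathcomp Require Import all_boot.
From mathcomp Require Import classical_sets cardinality.

Set Implicit Arguments.
Unset Strict Implicit.
Unset Printing Implicit Defensive.

Local Open Scope classical_set_scope.

Definition denumerable (T : Type) : Prop := ([set: T] #= [set: nat])%card.

(* Kleene's axiom schemes, over any type with negation, conjunction and
   disjunction.  Implication is not primitive: it abbreviates ~ a \/ b.  The
   schemes, together with modus ponens, are complete for classical logic. *)
Section Classical.
Variables (F : Type) (neg : F -> F) (conj disj : F -> F -> F).

Let imp (a b : F) : F := disj (neg a) b.

Inductive classical_axiom : F -> Prop :=
| cl_K a b : classical_axiom (imp a (imp b a))
| cl_S a b c :
    classical_axiom (imp (imp a (imp b c)) (imp (imp a b) (imp a c)))
| cl_conjI a b : classical_axiom (imp a (imp b (conj a b)))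
| cl_conjEl a b : classical_axiom (imp (conj a b) a)
| cl_conjEr a b : classical_axiom (imp (conj a b) b)
| cl_disjIl a b : classical_axiom (imp a (disj a b))
| cl_disjIr a b : classical_axiom (imp b (disj a b))
| cl_disjE a b c :
    classical_axiom (imp (imp a c) (imp (imp b c) (imp (disj a b) c)))
| cl_negI a b : classical_axiom (imp (imp a b) (imp (imp a (neg b)) (neg a)))
| cl_negE a : classical_axiom (imp (neg (neg a)) a).

End Classical.

Inductive kformula (Var : Type) : Type :=
| KVar of Var
| KNeg of kformula Var
| KBox of kformula Var
| KAnd of kformula Var & kformula Var
| KOr of kformula Var & kformula Var.

Definition KImp (Var : Type) (a b : kformula Var) : kformula Var :=
  KOr (KNeg a) b.

(* Uniform substitution is built in, since all axioms are schemes. *)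
Inductive K_theorem (Var : Type) : kformula Var -> Prop :=
| K_classical a :
    classical_axiom (@KNeg Var) (@KAnd Var) (@KOr Var) a -> K_theorem a
| K_distr a b : K_theorem (KImp (KBox (KImp a b)) (KImp (KBox a) (KBox b)))
| K_mp a b : K_theorem a -> K_theorem (KImp a b) -> K_theorem b
| K_nec a : K_theorem a -> K_theorem (KBox a).

Inductive formula (Var : Type) : Type :=
| FVar of Var
| FNeg of formula Var
| FBox of formula Var
| FCirc of formula Var
| FAnd of formula Var & formula Var
| FOr of formula Var & formula Var.

Declare Scope form_scope.
Delimit Scope form_scope with F.
Bind Scope form_scope with formula.

Notation "¬ a" := (FNeg a) (at level 35, right associativity) : form_scope.
Notation "□ a" := (FBox a) (at level 35, right associativity) : form_scope.
Notation "○ a" := (FCirc a) (at level 35, right associativity) : form_scope.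
Notation "a ∧ b" := (FAnd a b) (at level 40, left associativity) : form_scope.
Notation "a ∨ b" := (FOr a b) (at level 45, left associativity) : form_scope.

Definition FImp (Var : Type) (a b : formula Var) : formula Var := (¬ a ∨ b)%F.
Notation "a → b" := (FImp a b) (at level 55, right associativity) : form_scope.

Definition FIff (Var : Type) (a b : formula Var) : formula Var :=
  ((a → b) ∧ (b → a))%F.
Notation "a ↔ b" := (FIff a b) (at level 60, no associativity) : form_scope.

Definition FDia (Var : Type) (a : formula Var) : formula Var := (¬ □ ¬ a)%F.
Notation "◇ a" := (FDia a) (at level 35, right associativity) : form_scope.

Definition FXor (Var : Type) (a b : formula Var) : formula Var :=
  ((a ∧ ¬ b) ∨ (¬ a ∧ b))%F.
Notation "a ⊻ b" := (FXor a b) (at level 50, no associativity) : form_scope.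

Reserved Notation "S ⊢ a" (at level 70, a at level 65, no associativity).

Inductive derives (Var : Type) : set (formula Var) -> formula Var -> Prop :=
| d_refl (S : set (formula Var)) a : S a -> S ⊢ a
| d_mono (S S' : set (formula Var)) a : S `<=` S' -> S ⊢ a -> S' ⊢ a
| d_cut (S S' : set (formula Var)) a b :
    S ⊢ a -> S' `|` [set a] ⊢ b -> S `|` S' ⊢ b
| d_classical a :
    classical_axiom (@FNeg Var) (@FAnd Var) (@FOr Var) a -> set0 ⊢ a
| d_mp a b : [set a; a → b]%F ⊢ b
| d_DB a : set0 ⊢ ○ ○ a
| d_BR1 a : [set ○ a]%F ⊢ ○ ¬ a
| d_BR2 a : [set ○ ¬ a]%F ⊢ ○ a
| d_BF1 a b : [set ○ a; ○ b]%F ⊢ ○ (a ∧ b)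
| d_BF2 a b : [set ○ a; ○ b]%F ⊢ ○ (a ∨ b)
| d_AwB a b : [set a; ○ a]%F ⊢ ○ (a ∨ b)
| d_NwB a b : [set ¬ a; ○ a]%F ⊢ ○ (a ∧ b)
| d_NB a b : [set ¬ ○ a; ○ b]%F ⊢ ¬ ○ (a ∧ b) ∨ ¬ ○ (a ∨ b)
| d_TNB1 a b : [set ¬ ○ a; ¬ ○ b; a ∧ b]%F ⊢ ¬ ○ (a ∧ b)
| d_TNB2 a b : [set ¬ ○ a; ¬ ○ b; ¬ (a ∨ b)]%F ⊢ ¬ ○ (a ∧ b)
| d_BC a b : [set ○ (a ∧ b); a ∧ b]%F ⊢ ○ a ∧ ○ b
| d_OV a b : [set ○ a ↔ ○ b; a ↔ ¬ b]%F ⊢ ○ (a ∧ b)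
| d_IB a : set0 ⊢ a -> set0 ⊢ ○ a
| d_KA a b : set0 ⊢ □ (a → b) → (□ a → □ b)
| d_BB a : [set □ a; ○ □ a]%F ⊢ □ ○ a
| d_FC a : [set ◇ a; ◇ ¬ a]%F ⊢ ○ □ a
| d_EA a : [set ¬ ○ □ a]%F ⊢ ◇ (a ∧ ¬ ○ a) ⊻ ◇ (¬ a ∧ ¬ ○ a)
| d_IN (L G : set (formula Var)) a :
    L `|` G `|` (@FCirc Var @` G) ⊢ a ∧ ○ a -> L `|` G ⊢ a ->
    L `|` (@FBox Var @` G) ⊢ □ a
where "S ⊢ a" := (derives S a%F).

Fixpoint embed (Var : Type) (a : kformula Var) : formula Var :=
  match a with
  | KVar x => FVar x
  | KNeg b => FNeg (embed b)
  | KBox b => FBox (embed b)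
  | KAnd b c => FAnd (embed b) (embed c)
  | KOr b c => FOr (embed b) (embed c)
  end.

(* Main.v *)
Require Import Defs.
From mathcomp Require Import all_boot.
From mathcomp Require Import classical_sets cardinality.

Local Open Scope classical_set_scope.

(** The proof is an induction on K-derivations.  Classical axioms, distribution
    and modus ponens are available in the four-eight logic as they stand; the
    one K-rule it does not have is necessitation.  The boxing rule (IN) asks
    for more than K does: to box [a], one must also know that [a] is classical,
    i.e. derive [○ a].  For theorems this is no restriction, because (IB) says
    that theorems are classical.  Hence (IN), used with no side premises and no
    boxed premises, gives necessitation ([derives_nec]). *)

(** [d_mp] speaks only of the two-element premise set; cutting its two members
    one after the other makes it applicable over arbitrary premises. *)
Lemma derives_mp {Var : Type} {S : set (formula Var)} {a b : formula Var} :
  S ⊢ a -> S ⊢ a → b -> S ⊢ b.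
Proof.
move=> Sa Sab; rewrite -(setUid S); apply: (d_cut Sa).
rewrite -(setUid S) -setUA; apply: (d_cut Sab).
by apply: d_mono (d_mp a b) => x [->|->]; [left; right | right].
Qed.

Lemma derives_conj {Var : Type} {S : set (formula Var)} {a b : formula Var} :
  S ⊢ a -> S ⊢ b -> S ⊢ a ∧ b.
Proof.
move=> Sa Sb; apply: (derives_mp Sb); apply: (derives_mp Sa).
by apply: d_mono (@sub0set _ _) _; apply: d_classical; exact: cl_conjI.
Qed.

(** A theorem is classical by (IB), so both premises of (IN) hold already with
    empty sets of side and boxed premises. *)
Lemma derives_nec (Var : Type) (a : formula Var) : set0 ⊢ a -> set0 ⊢ □ a.
Proof.
move=> da; have := @d_IN Var set0 set0 a.
rewrite !image_set0 !setU0; apply; last exact: da.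
by apply: (derives_conj da); exact: d_IB.
Qed.

(** [embed] commutes with the connectives, so each Kleene scheme goes to an
    instance of the same scheme. *)
Lemma embed_classical (Var : Type) (a : kformula Var) :
  classical_axiom (@KNeg Var) (@KAnd Var) (@KOr Var) a ->
  classical_axiom (@FNeg Var) (@FAnd Var) (@FOr Var) (embed a).
Proof. by case=> * /=; constructor. Qed.

Theorem theorem4p1 (Var : Type) (hVar : denumerable Var)
    (phi : kformula Var) (hphi : K_theorem phi) :
  set0 ⊢ embed phi.
Proof.
elim: hphi => [a ax | a b | a b _ da _ dab | a _ da] /=.
- exact/d_classical/embed_classical.
- exact: d_KA.
- exact: derives_mp da dab.
- exact: derives_nec.
Qed.
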